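(* Let $\gamma,\gamma_0>0$, $V_0\ge0$ and $\Omega>\gamma$. Then for any $\rho>0$, there is no minimizer for $I_\Omega(\rho)$, i.e., $I_\Omega(\rho)=-\infty$.
   Context: Functions are complex-valued on $\mathbb{R}^2$, $x=(x_1,x_2)$. $V(x)=\frac{\gamma^2}{2}|x|^2+V_0e^{-\gamma_0|x|^2}$ and $L_z=i(x_2\partial_{x_1}-x_1\partial_{x_2})$. The space is $\Sigma=\{f\in H^1(\mathbb{R}^2): x\mapsto |x|f(x)\in L^2(\mathbb{R}^2)\}$. Put $L(f)=\int_{\mathbb{R}^2}\bar f\,L_zf\,dx$, $$E_\Omega(f)=\frac12\|\nabla f\|_{L^2}^2+\int_{\mathbb{R}^2}V|f|^2dx+\frac12\int_{\mathbb{R}^2}|f|^4\ln\left(\frac{|f|^2}{\sqrt e}\right)dx-\Omega L(f),$$ with the convention $|z|^4\ln(|z|^2)=0$ at $z=0$, and for $\rho>0$, $I_\Omega(\rho)=\inf\{E_\Omega(f): f\in\Sigma,\ \|f\|_{L^2}^2=\rho\}$. *)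

(* Defs.v *)
From HB Require Import structures.
From mathcomp Require Import all_boot all_order all_algebra.
From mathcomp Require Import complex.
From mathcomp Require Import all_classical all_reals all_analysis.
Set Implicit Arguments.
Unset Strict Implicit.
Unset Printing Implicit Defensive.
Import Order.TTheory GRing.Theory Num.Theory.
Import numFieldNormedType.Exports.
Local Open Scope classical_set_scope.
Local Open Scope ring_scope.
Local Open Scope complex_scope.

Section Defs.
Variable R : realType.

Definition lebesgue2 : {measure set (measurableTypeR R * measurableTypeR R) -> \bar R} :=
  (@lebesgue_measure R \x @lebesgue_measure R)%E.

(* The library's norm on R * R is the max norm; this is the Euclidean one. *)
Definition eucl (x : R * R) : R := Num.sqrt (x.1 ^+ 2 + x.2 ^+ 2).

(* Modulus with values in R (the library's `|z| has values in R[i]). *)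
Definition cabs (z : R[i]) : R := Normc.normc z.

Definition integral2 (f : R * R -> R) : R := Rintegral lebesgue2 setT f.

Definition cintegral2 (f : R * R -> R[i]) : R[i] :=
  integral2 (fun x => complex.Re (f x)) +i* integral2 (fun x => complex.Im (f x)).

(* Functions are not quotiented by almost everywhere equality. *)
Definition L2 (f : R * R -> R[i]) : Prop :=
  [/\ measurable_fun setT (fun x => complex.Re (f x)),
      measurable_fun setT (fun x => complex.Im (f x)) &
      (\int[lebesgue2]_x (cabs (f x) ^+ 2)%:E < +oo)%E].

Definition sqnormL2 (f : R * R -> R[i]) : R :=
  integral2 (fun x => cabs (f x) ^+ 2).

Definition e1 : R * R := (1, 0).
Definition e2 : R * R := (0, 1).

Fixpoint Ck (k : nat) (phi : R * R -> R) : Prop :=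
  continuous phi /\
  if k is k'.+1 then
    forall v, v = e1 \/ v = e2 ->
      (forall x, derivable phi x v) /\ Ck k' (fun x => 'D_v phi x)
  else True.

Definition test_function (phi : R * R -> R) : Prop :=
  (forall k, Ck k phi) /\ compact (closure [set x | phi x != 0]).

(* Real test functions suffice: complex ones follow by linearity. *)
Definition weak_derivative (v : R * R) (f g : R * R -> R[i]) : Prop :=
  forall phi, test_function phi ->
    cintegral2 (fun x => f x * ('D_v phi x)%:C) =
    - cintegral2 (fun x => g x * (phi x)%:C).

(* An element of H^1(R^2) is an L^2 function together with its weak gradient
   in L^2. The weak gradient is unique up to a null set, so carrying it as a
   field adds no information: quantities built from integrals of [H1_fun],
   [H1_d1], [H1_d2] depend only on the function. *)
Record H1 := MkH1 {
  H1_fun :> R * R -> R[i];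
  H1_d1 : R * R -> R[i];
  H1_d2 : R * R -> R[i];
  H1_L2 : L2 H1_fun;
  H1_d1_L2 : L2 H1_d1;
  H1_d2_L2 : L2 H1_d2;
  H1_d1_weak : weak_derivative e1 H1_fun H1_d1;
  H1_d2_weak : weak_derivative e2 H1_fun H1_d2
}.

Definition Sigma : set H1 :=
  [set f | L2 (fun x => (eucl x)%:C * f x)].

Definition potential (gamma gamma0 V0 : R) (x : R * R) : R :=
  gamma ^+ 2 / 2 * eucl x ^+ 2 + V0 * expR (- (gamma0 * eucl x ^+ 2)).

Definition Lz (f : H1) (x : R * R) : R[i] :=
  'i%C * (x.2%:C * H1_d1 f x - x.1%:C * H1_d2 f x).

Definition angular_momentum (f : H1) : R[i] :=
  cintegral2 (fun x => conjc (f x) * Lz f x).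

(* On [Sigma] all the integrands are integrable, and the angular momentum is
   a real number (Lz is symmetric), so that taking its real part only changes
   its type. Since [ln 0 = 0], the logarithmic integrand is 0 where f is. *)
Definition energy (gamma gamma0 V0 Omega : R) (f : H1) : R :=
  2^-1 * (sqnormL2 (H1_d1 f) + sqnormL2 (H1_d2 f))
  + integral2 (fun x => potential gamma gamma0 V0 x * cabs (f x) ^+ 2)
  + 2^-1 * integral2 (fun x =>
      cabs (f x) ^+ 4 * ln (cabs (f x) ^+ 2 / Num.sqrt (expR 1)))
  - Omega * complex.Re (angular_momentum f).

Definition admissible (rho : R) : set H1 :=
  [set f | Sigma f /\ sqnormL2 f = rho].

Definition min_energy (gamma gamma0 V0 Omega rho : R) : \bar R :=
  ereal_inf [set (energy gamma gamma0 V0 Omega f)%:E | f in admissible rho].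

Definition minimizer (gamma gamma0 V0 Omega rho : R) (f : H1) : Prop :=
  admissible rho f /\
  (energy gamma gamma0 V0 Omega f)%:E = min_energy gamma gamma0 V0 Omega rho.

End Defs.

(* Main.v *)
(** A condensate in rotation faster than the trap frequency can be moved away
    from the origin at an energy gain. Let the trial state be a Gaussian of mass
    [rho] translated to [(s, 0)] and boosted to the velocity [(0, Omega s)] of
    the rotating frame:
    [f_s(x) = c exp(- |x - (s, 0)|^2 / 4) exp(i Omega s x_2)].
    Up to terms at most linear in [s], the boost costs [Omega^2 s^2 rho / 2],
    the trap costs [gamma^2 s^2 rho / 2], and the rotation gains
    [Omega * (Omega s) * s rho], while the other terms do not see the
    translation. Hence the energy of [f_s] is at most
    [C0 + C1 s - (Omega^2 - gamma^2) rho s^2 / 2], which tends to [-oo]. *)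
Require Import Defs.
From mathcomp Require Import all_boot all_order all_algebra.
From mathcomp Require Import complex.
From mathcomp Require Import all_classical all_reals all_analysis.
From mathcomp Require Import measurable_realfun.
From mathcomp Require Import ring lra.
Set Implicit Arguments.
Unset Strict Implicit.
Unset Printing Implicit Defensive.
Import Order.TTheory GRing.Theory Num.Theory.
Import numFieldNormedType.Exports.
Local Open Scope classical_set_scope.
Local Open Scope ring_scope.
Local Open Scope complex_scope.

(* The same type and sigma-algebra as [R * R], but with the display of the
   domain of [lebesgue2]; naming it makes unification succeed. *)
Definition plane (R : realType) : measurableType _ :=
  (measurableTypeR R * measurableTypeR R)%type.

(** * Gaussian densities on the plane, and integrability by comparison with them *)

Section gauss.
Variable R : realType.
Local Notation mu2 := (@lebesgue2 R).

Definition rat_box (q : (rat * rat) * (rat * rat)) : set (R * R) :=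
  `]ratr q.1.1, ratr q.1.2[ `*` `]ratr q.2.1, ratr q.2.2[.

(** The product sigma-algebra is generated by rectangles. Writing an open set as a countable union
    of open boxes with rational corners makes it measurable there, and hence makes continuous
    functions on the plane measurable. *)
Lemma open_bigcup_rat_box (U : set (R * R)) : open U ->
  U = \bigcup_(q in [set q | rat_box q `<=` U]) rat_box q.
Proof.
move=> oU; apply/seteqP; split => [x Ux|x [q qU qx]]; last exact: qU.
have /nbhs_ballP[e /= e0 eU] : nbhs x U by exact: open_nbhs_nbhs.
have box_rat (t : R) : exists ab : rat * rat,
    [/\ t - e < ratr ab.1, ratr ab.1 < t, t < ratr ab.2 & ratr ab.2 < t + e].
  have [a] := @rat_in_itvoo R (t - e) t ltac:(lra).
  have [b] := @rat_in_itvoo R t (t + e) ltac:(lra).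
  rewrite !in_itv/= => /andP[? ?] /andP[? ?].
  by exists (a, b).
have [p [p1 p2 p3 p4]] := box_rat x.1.
have [q [q1 q2 q3 q4]] := box_rat x.2.
exists (p, q).
  move=> y; rewrite /rat_box/= !in_itv/= => -[/andP[? ?] /andP[? ?]].
  apply: eU; split; rewrite /= /ball/= ltr_norml; lra.
by rewrite /rat_box/= !in_itv/=; split; apply/andP.
Qed.

Lemma continuous_measurable2 (f : R * R -> R) : continuous f ->
  measurable_fun [set: plane R] f.
Proof.
move=> /continuousP cf.
apply: (measurability _ (RGenOpens.measurableE R)) => _ [_ [a [b ->] <-]].
rewrite setTI (open_bigcup_rat_box (cf _ (interval_open _ _)))//.
rewrite bigcup_mkcond; apply: countable_bigcupT_measurable => // q.
by case: ifPn => // _; apply: measurableX; exact: measurable_itv.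
Qed.

(** The normal density with mean [(s, 0)] and standard deviation [sg] in each coordinate. The value
    [sg = 1] describes the squared trial state, and [sg = 2] serves as a wider dominating
    function. *)
Definition gauss (sg s : R) (x : R * R) : R :=
  normal_pdf s sg x.1 * normal_pdf 0 sg x.2.

Lemma gauss_ge0 sg s x : 0 <= gauss sg s x.
Proof. by rewrite mulr_ge0// normal_pdf_ge0. Qed.

Lemma measurable_gauss sg s :
  measurable_fun [set: plane R] (gauss sg s).
Proof.
by apply: measurable_funM;
  apply: measurableT_comp => //; exact: measurable_normal_pdf.
Qed.

Lemma integral_gauss sg s : (\int[mu2]_x (gauss sg s x)%:E = 1)%E.
Proof.
rewrite /lebesgue2 fubini_tonelli1 /fubini_F /=; first last.
- by move=> x; rewrite lee_fin gauss_ge0.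
- by apply/measurable_EFinP; exact: measurable_gauss.
under eq_integral => x _.
  rewrite /gauss/=.
  under eq_integral do rewrite EFinM.
  rewrite integralZl//=; last exact: integrable_normal_pdf.
  rewrite integral_normal_pdf mule1.
  over.
exact: integral_normal_pdf.
Qed.

Lemma integrable_gauss sg s :
  mu2.-integrable setT (EFin \o gauss sg s).
Proof.
apply/integrableP; split.
  by apply/measurable_EFinP; exact: measurable_gauss.
under eq_integral do rewrite gee0_abs ?lee_fin ?gauss_ge0//.
by rewrite integral_gauss ltry.
Qed.

(** Since [gauss 2 s] has total mass 1 for every [s], the constant of a pointwise bound is also a
    bound of the integral, uniformly in the translation. *)
Lemma gauss_dominated (f : R * R -> R) K s :
  measurable_fun [set: plane R] f ->
  (forall x, `|f x| <= K * gauss 2 s x) ->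
  mu2.-integrable setT (EFin \o f) /\ `|integral2 f| <= K.
Proof.
move=> mf fK.
have intK : mu2.-integrable setT (EFin \o (fun x => K * gauss 2 s x)).
  exact: (integrableZl measurableT K (integrable_gauss 2 s)).
have intf : mu2.-integrable setT (EFin \o f).
  apply: le_integrable intK => //; first exact/measurable_EFinP.
  by move=> x _ /=; rewrite lee_fin (le_trans (fK x))// ler_norm.
split => //.
apply: (le_trans (le_normr_Rintegral _ _)) => //.
rewrite -[leRHS]mulr1 -[X in K * X](_ : Rintegral mu2 setT (gauss 2 s) = _); last first.
  by rewrite /Rintegral integral_gauss.
rewrite -RintegralZl//; last exact: integrable_gauss.
apply: le_Rintegral => //.
by apply: (le_integrable _ _ _ intf) => //= [|x _]; rewrite ?normr_id//;
 apply/measurable_EFinP; exact: measurableT_comp.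
Qed.

End gauss.

(** * Vanishing of the integral of a compactly supported derivative *)

Section divergence.
Variable R : realType.
Local Notation mu2 := (@lebesgue2 R).

(* By conversion: only the displays differ. *)
Lemma measurable_fun_plane (f : R * R -> R) :
  measurable_fun [set: plane R] f -> measurable_fun [set: R * R] f.
Proof. by []. Qed.

Lemma Rintegral_deriv_eq0 (h h' : R -> R) (A : R) : 
  (forall t : R, is_derive t (1 : R) h (h' t)) -> continuous h' ->
  (forall t, A < `|t| -> h t = 0 /\ h' t = 0) ->
  (\int[@lebesgue_measure R]_t (h' t)%:E = 0)%E.
Proof.
move=> dh ch' h0.
(* [B] is positive and exceeds [A], so the interval is nondegenerate, it contains the support, and
   [h] vanishes at both of its endpoints. *)
set B := `|A| + 1.
have AB : A < B by rewrite ltr_pwDr// ler_norm.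
have B0 : 0 < B by rewrite ltr_pwDr.
have ch : continuous h.
  move=> t; apply: differentiable_continuous; apply/derivable1_diffP.
  exact: (@ex_derive _ _ _ _ _ _ _ (dh t)).
pose I : set R := `[- B, B]%classic.
rewrite (_ : (\int[_]_t _)%E = (\int[@lebesgue_measure R]_(t in I) (h' t)%:E)%E); last first.
  rewrite [RHS]integral_mkcond; apply: eq_integral => t _.
  rewrite patchE; case: ifPn => //; rewrite notin_setE/I/= in_itv/= => tB.
  have [|_ ->//] := h0 t.
  rewrite (lt_le_trans AB)// leNgt ltr_norml.
  by apply/negP => /andP[/ltW ? /ltW ?]; apply: tB; apply/andP.
rewrite (@continuous_FTC2 _ _ h).
- have [|-> _] := h0 B; first by rewrite gtr0_norm.
  have [|-> _] := h0 (-B); first by rewrite normrN gtr0_norm.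
  by rewrite subee.
- by rewrite gtrN.
- exact: continuous_subspaceT.
- split.
  + by move=> t _; apply: (@ex_derive _ _ _ _ _ _ _ (dh t)).
  + apply: cvg_at_right_filter; exact: ch.
  + apply: cvg_at_left_filter; exact: ch.
- move=> t _; rewrite derive1E; exact: (@derive_val _ _ _ _ _ _ _ (dh t)).
Qed.

(** Moving along [e1] freezes the second coordinate, so both difference quotients are the same
    function of the increment. This reduces partial derivatives to one-variable calculus. *)
Lemma is_derive_e1 (H : R * R -> R) (x : R * R) (d : R) :
  is_derive x (e1 R) H d <-> is_derive x.1 (1 : R) (fun t => H (t, x.2)) d.
Proof.
have E : (fun h => h^-1 *: ((H \o shift x) (h *: e1 R) - H x)) =
  (fun h => h^-1 *: (((fun t => H (t, x.2)) \o shift x.1) (h *: (1:R)) - H (x.1, x.2))).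
  apply/funext => h /=; rewrite /e1/shift/=; congr (_ *: (H _ - H _)) => //.
    by congr pair; rewrite /= scaler0 add0r.
  by case: x.
by split => -[D V]; split; move: D V; rewrite /derivable/derive E.
Qed.

Lemma is_derive_e2 (H : R * R -> R) (x : R * R) (d : R) :
  is_derive x (e2 R) H d <-> is_derive x.2 (1 : R) (fun t => H (x.1, t)) d.
Proof.
have E : (fun h => h^-1 *: ((H \o shift x) (h *: e2 R) - H x)) =
  (fun h => h^-1 *: (((fun t => H (x.1, t)) \o shift x.2) (h *: (1:R)) - H (x.1, x.2))).
  apply/funext => h /=; rewrite /e2/shift/=; congr (_ *: (H _ - H _)) => //.
    by congr pair; rewrite /= scaler0 add0r.
  by case: x.
by split => -[D V]; split; move: D V; rewrite /derivable/derive E.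
Qed.

Lemma continuous_slice1 (f : R * R -> R) (y : R) :
  continuous f -> continuous (fun t => f (t, y)).
Proof.
move=> cf t; apply: (@continuous_comp _ _ _ (fun t : R => (t, y)) f); last exact: cf.
by apply: (@cvg_pair _ _ _ _ (nbhs _) (nbhs _)); [exact: cvg_id|exact: cvg_cst].
Qed.

Lemma continuous_slice2 (f : R * R -> R) (x : R) :
  continuous f -> continuous (fun t => f (x, t)).
Proof.
move=> cf t; apply: (@continuous_comp _ _ _ (fun t : R => (x, t)) f); last exact: cf.
by apply: (@cvg_pair _ _ _ _ (nbhs _) (nbhs _)); [exact: cvg_cst|exact: cvg_id].
Qed.

(** By Fubini one may integrate first along the direction [v]; each inner integral is then that of a
    compactly supported derivative on a line. *)
Lemma integral2_deriv_eq0 (v : R * R) (H H' : R * R -> R) (A : R) :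
  v = e1 R \/ v = e2 R ->
  (forall x, is_derive x v H (H' x)) -> continuous H' ->
  (forall x, A < `|x.1| \/ A < `|x.2| -> H x = 0 /\ H' x = 0) ->
  mu2.-integrable setT (EFin \o H') ->
  integral2 H' = 0.
Proof.
move=> ve dH cH' H0 iH'; rewrite /integral2 /Rintegral.
case: ve => ve; rewrite ve in dH.
- rewrite [X in fine X](_ : _ = 0%E)//.
  rewrite -[LHS](integral21_prod_meas1 iH') /fubini_G /= integral0_eq// => y _.
  apply: (@Rintegral_deriv_eq0 (fun t => H (t, y)) _ A).
  + by move=> t; exact: ((is_derive_e1 H (t, y) _).1 (dH (t, y))).
  + exact: continuous_slice1.
  + by move=> t At; apply: H0; left.
- rewrite [X in fine X](_ : _ = 0%E)//.
  rewrite -[LHS](integral12_prod_meas1 iH') /fubini_F /= integral0_eq// => y _.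
  apply: (@Rintegral_deriv_eq0 (fun t => H (y, t)) _ A).
  + by move=> t; exact: ((is_derive_e2 H (y, t) _).1 (dH (y, t))).
  + exact: continuous_slice2.
  + by move=> t At; apply: H0; right.
Qed.

End divergence.

(** * Classical derivatives with Gaussian decay are weak derivatives *)

Section weak_derivatives.
Variable R : realType.
Local Notation mu2 := (@lebesgue2 R).

Lemma continuous_bounded_support (psi : R * R -> R) (K : set (R * R)) :
  compact K -> continuous psi -> (forall x, ~ K x -> psi x = 0) ->
  exists2 M, 0 <= M & forall x, `|psi x| <= M.
Proof.
move=> cK cpsi psi0.
have : compact (psi @` K).
  by apply: continuous_compact => //; exact: continuous_subspaceT.
move=> /compact_bounded[M [_ HM]].
exists (`|M| + 1) => [|x]; first by rewrite addr_ge0.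
have [Kx|/psi0 ->] := pselect (K x); last by rewrite normr0 addr_ge0.
by apply: (HM (`|M| + 1)); [rewrite ltr_pwDr// ler_norm|exists x].
Qed.

Lemma test_function_regular (v : R * R) (phi : R * R -> R) :
  v = e1 R \/ v = e2 R -> test_function phi ->
  [/\ continuous phi /\ continuous (fun x => 'D_v phi x),
      forall x, is_derive x v phi ('D_v phi x),
      exists A, forall x, A < `|x.1| \/ A < `|x.2| ->
        phi x = 0 /\ 'D_v phi x = 0 &
      exists2 M, 0 <= M & forall x, `|phi x| <= M /\ `|'D_v phi x| <= M].
Proof.
move=> ve [Cphi]; set K := closure _ => cK.
have [_ /(_ v ve)[dphi [cDphi _]]] := Cphi 1%N.
have [cphi _] := Cphi 0%N.
have phi0 x : ~ K x -> phi x = 0.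
  by apply: contra_notP => /eqP px; exact: subset_closure.
(* The complement of the closed set [K] is open, so near such a point [phi] coincides with the
   constant 0 and has the same derivative. *)
have Dphi0 x : ~ K x -> 'D_v phi x = 0.
  move=> nKx; rewrite -(@derive_cst _ _ _ (0 : R) x v).
  apply: near_eq_derive.
  have : nbhs x (~` K).
    by apply: open_nbhs_nbhs; split => //; exact/closed_openC/closed_closure.
  by apply: filterS => y nKy; rewrite phi0.
split => //.
- have [A [_ HA]] := compact_bounded cK.
  exists (`|A| + 1) => x xA.
  have nKx : ~ K x.
    have A1 : A < `|A| + 1 by rewrite ltr_pwDr// ler_norm.
    move=> /(HA _ A1) /=; rewrite prod_normE ge_max => /andP[].
    by case: xA => /lt_geF ->.
  by rewrite phi0// Dphi0.
- have [M M0 HM] := continuous_bounded_support cK cphi phi0.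
  have [N N0 HN] := continuous_bounded_support cK cDphi Dphi0.
  exists (M + N); first exact: addr_ge0.
  by move=> x; rewrite (le_trans (HM x)) ?lerDl// (le_trans (HN x)) ?lerDr.
Qed.

(** The two integrands add up to the derivative of [F * phi], which inherits the compact support of
    [phi]. The Gaussian bounds on [F] and [dF] provide the integrability needed to split the
    integral and to apply Fubini. *)
Lemma integral2_by_parts (v : R * R) (F dF phi : R * R -> R) (C s : R) :
  v = e1 R \/ v = e2 R ->
  continuous F -> continuous dF -> (forall x, is_derive x v F (dF x)) ->
  (forall x, `|F x| <= C * gauss 2 s x) ->
  (forall x, `|dF x| <= C * gauss 2 s x) ->
  test_function phi ->
  integral2 (fun x => F x * 'D_v phi x) = - integral2 (fun x => dF x * phi x).
Proof.
move=> ve cF cdF dFv FC dFC tphi.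
have [[cphi cDphi] dphi [A phiA] [M M0 phiM]] := test_function_regular ve tphi.
have cM (f g : R * R -> R) : continuous f -> continuous g ->
    continuous (fun x => f x * g x).
  by move=> cf cg x; apply: cvgM; [exact: cf|exact: cg].
have dom (f g : R * R -> R) : continuous f -> continuous g ->
    (forall x, `|f x| <= C * gauss 2 s x) -> (forall x, `|g x| <= M) ->
    mu2.-integrable setT (EFin \o (fun x => f x * g x)).
  move=> cf cg fC gM.
  have := @gauss_dominated R (fun x => f x * g x) (C * M) s _ _.
  case=> //.
    by apply: continuous_measurable2; exact: cM.
  by move=> x; rewrite normrM mulrAC ler_pM.
have i1 := dom F (fun x => 'D_v phi x) cF cDphi FC (fun x => (phiM x).2).
have i2 := dom dF phi cdF cphi dFC (fun x => (phiM x).1).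
apply/eqP; rewrite -addr_eq0; apply/eqP.
rewrite /integral2 -(RintegralD _ i1 i2)//.
apply: (@integral2_deriv_eq0 R v (fun x => F x * phi x) _ A) => //.
- move=> x.
  rewrite (_ : _ + _ = F x *: 'D_v phi x + phi x *: dF x); last first.
    by rewrite /GRing.scale/= [phi x * _]mulrC.
  exact: is_deriveM.
- have cD : continuous (fun x => F x * 'D_v phi x + dF x * phi x).
    move=> x; apply: cvgD; [exact: (cM _ _ cF cDphi)|exact: (cM _ _ cdF cphi)].
  exact: cD.
- by move=> x /phiA[-> ->]; rewrite !mulr0 addr0.
- exact: (integrableD _ i1 i2).
Qed.

(** Test functions are real, so the identity separates into one integration by parts for the real
    part and one for the imaginary part. *)
Lemma weak_derivative_classical (v : R * R) (f g : R * R -> R[i]) (C s : R) :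
  v = e1 R \/ v = e2 R ->
  continuous (fun x => complex.Re (f x)) ->
  continuous (fun x => complex.Im (f x)) ->
  continuous (fun x => complex.Re (g x)) ->
  continuous (fun x => complex.Im (g x)) ->
  (forall x, is_derive x v (fun x => complex.Re (f x)) (complex.Re (g x))) ->
  (forall x, is_derive x v (fun x => complex.Im (f x)) (complex.Im (g x))) ->
  (forall x, cabs (f x) <= C * gauss 2 s x) ->
  (forall x, cabs (g x) <= C * gauss 2 s x) ->
  weak_derivative v f g.
Proof.
move=> ve cfr cfi cgr cgi dr di fC gC phi tphi.
have Rele (z : R[i]) : `|complex.Re z| <= cabs z.
  by case: z => a b /=; rewrite -[leLHS]sqrtr_sqr ler_wsqrtr// lerDl sqr_ge0.
have Imle (z : R[i]) : `|complex.Im z| <= cabs z.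
  by case: z => a b /=; rewrite -[leLHS]sqrtr_sqr ler_wsqrtr// lerDr sqr_ge0.
have ReM (h : R * R -> R[i]) (r : R * R -> R) :
    (fun x => complex.Re (h x * (r x)%:C)) = (fun x => complex.Re (h x) * r x).
  by apply/funext => x; case: (h x) => a b /=; rewrite mulr0 subr0.
have ImM (h : R * R -> R[i]) (r : R * R -> R) :
    (fun x => complex.Im (h x * (r x)%:C)) = (fun x => complex.Im (h x) * r x).
  by apply/funext => x; case: (h x) => a b /=; rewrite mulr0 add0r.
rewrite /cintegral2 !ReM !ImM.
have bd (p : R[i] -> R) (h : R * R -> R[i]) : (forall z, `|p z| <= cabs z) ->
    (forall x, cabs (h x) <= C * gauss 2 s x) ->
    forall x, `|p (h x)| <= C * gauss 2 s x.
  by move=> pc hC x; exact: le_trans (pc _) (hC x).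
rewrite (integral2_by_parts ve cfr cgr dr (bd _ _ Rele fC) (bd _ _ Rele gC) tphi).
by rewrite (integral2_by_parts ve cfi cgi di (bd _ _ Imle fC) (bd _ _ Imle gC) tphi).
Qed.

End weak_derivatives.

(** * Continuity of explicit formulas on the plane *)

Section continuity.
Variable R : realType.
Implicit Types f g : R * R -> R.

Lemma continuous_fst2 : continuous (fun x : R * R => x.1).
Proof. by move=> x; exact: cvg_fst. Qed.

Lemma continuous_snd2 : continuous (fun x : R * R => x.2).
Proof. by move=> x; exact: cvg_snd. Qed.

Lemma continuous_cst2 (c : R) : continuous (fun _ : R * R => c).
Proof. by move=> x; exact: cvg_cst. Qed.

Lemma continuous_add2 f g : continuous f -> continuous g ->
  continuous (fun x => f x + g x).
Proof. by move=> cf cg x; apply: cvgD; [exact: cf|exact: cg]. Qed.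

Lemma continuous_opp2 f : continuous f -> continuous (fun x => - f x).
Proof. by move=> cf x; apply: cvgN; exact: cf. Qed.

Lemma continuous_mul2 f g : continuous f -> continuous g ->
  continuous (fun x => f x * g x).
Proof. by move=> cf cg x; apply: cvgM; [exact: cf|exact: cg]. Qed.

Lemma continuous_exp2 f n : continuous f -> continuous (fun x => f x ^+ n).
Proof.
move=> cf; elim: n => [|n IHn].
  by under [X in continuous X]eq_fun do rewrite expr0; exact: continuous_cst2.
under [X in continuous X]eq_fun do rewrite exprS.
exact: continuous_mul2.
Qed.

Lemma continuous_comp2 (h : R -> R) f : continuous h -> continuous f ->
  continuous (fun x => h (f x)).
Proof. by move=> ch cf x; exact: (continuous_comp (cf x) (ch _)). Qed.

Lemma continuous_expR2 f : continuous f -> continuous (fun x => expR (f x)).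
Proof. exact/continuous_comp2/continuous_expR. Qed.

Lemma continuous_cos2 f : continuous f -> continuous (fun x => cos (f x)).
Proof. exact/continuous_comp2/continuous_cos. Qed.

Lemma continuous_sin2 f : continuous f -> continuous (fun x => sin (f x)).
Proof. exact/continuous_comp2/continuous_sin. Qed.

Lemma continuous_sqrt2 f : continuous f ->
  continuous (fun x => Num.sqrt (f x)).
Proof. exact/continuous_comp2/sqrt_continuous. Qed.

End continuity.

Ltac continuity := lazymatch goal with
  | |- continuous (fun x => fst x) => exact: continuous_fst2
  | |- continuous (fun x => snd x) => exact: continuous_snd2
  | |- continuous (fun x => @?f x + @?g x) =>
      refine (@continuous_add2 _ f g _ _); continuity
  | |- continuous (fun x => - @?f x) => refine (@continuous_opp2 _ f _); continuity
  | |- continuous (fun x => @?f x * @?g x) =>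
      refine (@continuous_mul2 _ f g _ _); continuity
  | |- continuous (fun x => @?f x ^+ ?n) =>
      refine (@continuous_exp2 _ f n _); continuity
  | |- continuous (fun x => expR (@?f x)) =>
      refine (@continuous_expR2 _ f _); continuity
  | |- continuous (fun x => cos (@?f x)) =>
      refine (@continuous_cos2 _ f _); continuity
  | |- continuous (fun x => sin (@?f x)) =>
      refine (@continuous_sin2 _ f _); continuity
  | |- continuous (fun x => Num.sqrt (@?f x)) =>
      refine (@continuous_sqrt2 _ f _); continuity
  | |- continuous (fun _ => ?c) => exact: continuous_cst2
  end.

(** * The trial state and Gaussian bounds for its modulus *)

Section envelope.
Variable R : realType.
Variables (c s a : R).
Hypothesis c0 : 0 < c.
Local Notation mu2 := (@lebesgue2 R).

(** The modulus of the trial state. The factor 1/4 in the exponent makes its square a multiple of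
    the density [gauss 1 s]. *)
Definition envelope (x : R * R) : R :=
  c * expR (- ((x.1 - s) ^+ 2 + x.2 ^+ 2) / 4).

Definition trial (x : R * R) : R[i] :=
  (envelope x * cos (a * x.2)) +i* (envelope x * sin (a * x.2)).

Definition trial_d1 (x : R * R) : R[i] :=
  (- (x.1 - s) / 2 * envelope x * cos (a * x.2)) +i*
  (- (x.1 - s) / 2 * envelope x * sin (a * x.2)).

Definition trial_d2 (x : R * R) : R[i] :=
  (envelope x * (- (x.2 / 2) * cos (a * x.2) - a * sin (a * x.2))) +i*
  (envelope x * (- (x.2 / 2) * sin (a * x.2) + a * cos (a * x.2))).

(** A common majorant, up to constants, for the quadratic factors in the energy densities. It is
    centred where the envelope is, so that weighted integrals are bounded uniformly in [s]. *)
Definition weight (x : R * R) : R := 1 + (x.1 - s) ^+ 2 + x.2 ^+ 2.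

Lemma envelope_gt0 x : 0 < envelope x.
Proof. by rewrite mulr_gt0// expR_gt0. Qed.

Lemma envelope_le x : envelope x <= c.
Proof.
rewrite ler_piMr ?(ltW c0)// -expR0 ler_expR.
by rewrite mulNr oppr_le0 divr_ge0// addr_ge0// sqr_ge0.
Qed.

Lemma sqr_envelope x : envelope x ^+ 2 = c ^+ 2 / normal_peak 1 ^+ 2 * gauss 1 s x.
Proof.
rewrite /gauss !normal_pdfE// /normal_fun /envelope.
have p0 : normal_peak (1 : R) != 0 by rewrite gt_eqF// normal_peak_gt0.
rewrite exprMn [expR _ ^+ 2]expr2 -expRD.
rewrite [X in _ = _ * X]mulrACA -[normal_peak 1 * _]expr2 -expRD.
rewrite mulrA divfK ?expf_neq0//; congr (_ * expR _); by field.
Qed.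

(** With [r] the squared distance to [(s, 0)], [exp(- r / 4)] splits into two factors
    [exp(- r / 8)]. One absorbs the weight, by [1 + r <= 8 (1 + r / 8) <= 8 exp(r / 8)]; the other
    is a Gaussian of standard deviation 2. *)
Lemma weight_envelope_le x :
  weight x * envelope x <= 8 * c / normal_peak 2 ^+ 2 * gauss 2 s x.
Proof.
have n2 : (2 : R) != 0 by rewrite pnatr_eq0.
rewrite /gauss !normal_pdfE// /normal_fun /envelope.
have p0 : normal_peak (2 : R) != 0 by rewrite gt_eqF// normal_peak_gt0.
rewrite [X in _ <= _ * X]mulrACA -[normal_peak 2 * _]expr2 [leRHS]mulrA.
rewrite divfK ?expf_neq0// -expRD.
set r := (x.1 - s) ^+ 2 + x.2 ^+ 2.
have r0 : 0 <= r by rewrite addr_ge0// sqr_ge0.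
rewrite (_ : _ + _ = - r / 8); last by rewrite /r; field.
rewrite [expR _](_ : _ = expR (- r / 8) * expR (- r / 8)); last first.
  by rewrite -expRD; congr expR; field.
rewrite mulrA mulrA ler_wpM2r ?expR_ge0//.
rewrite (_ : weight x = 1 + r); last by rewrite /weight/r; ring.
rewrite mulrAC ler_wpM2r ?(ltW c0)// mulNr expRN ler_pdivrMr ?expR_gt0//.
have := expR_ge1Dx (r / 8); lra.
Qed.

End envelope.

(** * Derivatives of the trial state and its membership in [H1] and [Sigma] *)

Section trial.
Variable R : realType.
Variables (c s a : R).
Hypothesis c0 : 0 < c.
Local Notation mu2 := (@lebesgue2 R).
Local Notation envelope := (envelope c s).
Local Notation trial := (trial c s a).
Local Notation trial_d1 := (trial_d1 c s a).
Local Notation trial_d2 := (trial_d2 c s a).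
Local Notation weight := (weight s).
Local Notation C1 := (8 * c / normal_peak 2 ^+ 2).

Lemma continuous_envelope : continuous envelope.
Proof. by rewrite /envelope; continuity. Qed.

Lemma is_derive_gauss (k m t : R) :
  is_derive t (1 : R) (fun t => c * expR (- ((t - m) ^+ 2 + k) / 4))
    (- (t - m) / 2 * (c * expR (- ((t - m) ^+ 2 + k) / 4))).
Proof.
have d1 : is_derive t (1 : R) (fun t => - ((t - m) ^+ 2 + k) / 4) (- (t - m) / 2).
  rewrite (_ : (fun t => - ((t - m) ^+ 2 + k) / 4) =
    (- (4^-1)) *: ((id \- cst m) ^+ 2 + cst k)); last first.
    by apply/funext => u; rewrite !fctE /GRing.scale/=; ring.
  apply: is_derive_eq; rewrite /GRing.scale/= ?fctE/=; by field.
have h := is_deriveZ c (is_derive1_comp (is_derive_expR _) d1).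
by apply: is_derive_eq h _; rewrite /GRing.scale/=; ring.
Qed.

Lemma is_derive_cosM (t : R) :
  is_derive t (1 : R) (fun t => cos (a * t)) (- a * sin (a * t)).
Proof.
have d1 : is_derive t (1 : R) (a *: id) (a * 1) by apply: is_derive_eq.
have h := is_derive1_comp (is_derive_cos _) d1.
by apply: is_derive_eq h _; ring.
Qed.

Lemma is_derive_sinM (t : R) :
  is_derive t (1 : R) (fun t => sin (a * t)) (a * cos (a * t)).
Proof.
have d1 : is_derive t (1 : R) (a *: id) (a * 1) by apply: is_derive_eq.
have h := is_derive1_comp (is_derive_sin _) d1.
by apply: is_derive_eq h _; ring.
Qed.

Lemma is_derive_envelope1 (x : R * R) :
  is_derive x (e1 R) envelope (- (x.1 - s) / 2 * envelope x).
Proof.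
exact: ((is_derive_e1 envelope x _).2 (is_derive_gauss (x.2 ^+ 2) s x.1)).
Qed.

Lemma is_derive_envelope2 (x : R * R) :
  is_derive x (e2 R) envelope (- (x.2 / 2) * envelope x).
Proof.
apply/is_derive_e2.
have := is_derive_gauss ((x.1 - s) ^+ 2) 0 x.2.
rewrite subr0 [_ + _ ^+ 2]addrC mulNr.
suff -> : (fun t => c * expR (- ((t - 0) ^+ 2 + (x.1 - s) ^+ 2) / 4)) =
  (fun t => envelope (x.1, t)) by [].
by apply/funext => t; rewrite subr0 addrC.
Qed.

Lemma is_derive_phase1 (h : R -> R) (x : R * R) :
  is_derive x (e1 R) (fun x => h x.2) 0.
Proof. by apply/is_derive_e1 => /=; exact: is_derive_cst. Qed.

Lemma is_derive_cos2 (x : R * R) :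
  is_derive x (e2 R) (fun x => cos (a * x.2)) (- a * sin (a * x.2)).
Proof. by apply/is_derive_e2; exact: is_derive_cosM. Qed.

Lemma is_derive_sin2 (x : R * R) :
  is_derive x (e2 R) (fun x => sin (a * x.2)) (a * cos (a * x.2)).
Proof. by apply/is_derive_e2; exact: is_derive_sinM. Qed.

Lemma sqr_cabs (z : R[i]) : cabs z ^+ 2 = complex.Re z ^+ 2 + complex.Im z ^+ 2.
Proof. by case: z => u v /=; rewrite sqr_sqrtr// addr_ge0// sqr_ge0. Qed.

Lemma cabs_ge0 (z : R[i]) : 0 <= cabs z.
Proof. by case: z => u v; exact: sqrtr_ge0. Qed.

Lemma sqr_cabsZ (r : R) (z : R[i]) : cabs (r%:C * z) ^+ 2 = r ^+ 2 * cabs z ^+ 2.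
Proof. by rewrite !sqr_cabs; case: z => u v /=; ring. Qed.

Lemma sqr_cabs_trial x : cabs (trial x) ^+ 2 = envelope x ^+ 2.
Proof. by rewrite sqr_cabs/= !exprMn -mulrDr cos2Dsin2 mulr1. Qed.

Lemma sqr_cabs_trial_d1 x :
  cabs (trial_d1 x) ^+ 2 = ((x.1 - s) ^+ 2 / 4) * envelope x ^+ 2.
Proof.
rewrite sqr_cabs/= !exprMn -mulrDr cos2Dsin2 mulr1; congr (_ * _).
by rewrite sqrrN exprVn -natrX.
Qed.

(** The derivative of the envelope and that of the phase are in quadrature: the cross terms in
    [cos * sin] cancel, and the boost contributes exactly [a ^+ 2] times the density. *)
Lemma sqr_cabs_trial_d2 x :
  cabs (trial_d2 x) ^+ 2 = (x.2 ^+ 2 / 4 + a ^+ 2) * envelope x ^+ 2.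
Proof.
rewrite sqr_cabs/= !exprMn -mulrDr mulrC; congr (_ * _).
transitivity ((x.2 ^+ 2 / 4 + a ^+ 2) * (cos (a * x.2) ^+ 2 + sin (a * x.2) ^+ 2)).
  by field.
by rewrite cos2Dsin2 mulr1.
Qed.

Lemma weight_ge1 x : 1 <= weight x.
Proof. by rewrite /weight -addrA lerDl addr_ge0// sqr_ge0. Qed.

Lemma weighted_envelope_le (q : R * R -> R) (k : R) x :
  `|q x| <= k * weight x -> `|q x * envelope x| <= k * C1 * gauss 2 s x.
Proof.
move=> qk; have e0 := envelope_gt0 s c0 x.
have k0 : 0 <= k.
  by rewrite -(pmulr_lge0 _ (lt_le_trans ltr01 (weight_ge1 x))) (le_trans _ qk).
rewrite normrM (gtr0_norm e0) (le_trans (ler_wpM2r (ltW e0) qk))//.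
by have := ler_wpM2l k0 (weight_envelope_le s c0 x); rewrite !mulrA.
Qed.

(** One factor of the envelope absorbs the weight, the other is bounded by its maximum [c]. *)
Lemma weighted_sqr_envelope_le (q : R * R -> R) (k : R) x :
  `|q x| <= k * weight x ->
  `|q x * envelope x ^+ 2| <= k * (C1 * c) * gauss 2 s x.
Proof.
move=> qk; have e0 := envelope_gt0 s c0 x.
have h := weighted_envelope_le qk.
rewrite [envelope x ^+ 2]expr2 [q x * _]mulrA normrM [`|envelope x|]gtr0_norm//.
have := ler_pM (normr_ge0 _) (ltW e0) h (envelope_le s c0 x).
by congr (_ <= _); ring.
Qed.

(** After squaring, it suffices that [1 + a ^+ 2 <= (1 + |a|) ^+ 2] and that the weight, being at
    least 1, is below its square. *)
Lemma cabs_le_gauss (z : R[i]) (q : R) x :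
  cabs z ^+ 2 = q * envelope x ^+ 2 -> q <= (1 + a ^+ 2) * weight x ->
  cabs z <= (1 + `|a|) * C1 * gauss 2 s x.
Proof.
move=> zq qle; have e0 := envelope_gt0 s c0 x; have w1 := weight_ge1 x.
have k0 : 0 <= 1 + `|a| by rewrite addr_ge0.
apply: (@le_trans _ _ (`|((1 + `|a|) * weight x) * envelope x|)); last first.
  apply: (@weighted_envelope_le (fun x => (1 + `|a|) * weight x)).
  by rewrite ger0_norm// mulr_ge0// (le_trans ler01).
rewrite -ler_sqr ?nnegrE ?cabs_ge0 ?normr_ge0//.
rewrite zq real_normK ?num_real// [(_ * envelope x) ^+ 2]exprMn ler_wpM2r ?sqr_ge0//.
rewrite (le_trans qle)// exprMn ler_pM ?addr_ge0 ?sqr_ge0 ?(le_trans ler01)//.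
  by rewrite -[a ^+ 2]real_normK ?num_real//; have := normr_ge0 a; nra.
by rewrite expr2 ler_peMr// (le_trans ler01).
Qed.

Lemma cabs_trial_le x : cabs (trial x) <= (1 + `|a|) * C1 * gauss 2 s x.
Proof.
apply: (cabs_le_gauss (q := 1)); first by rewrite mul1r sqr_cabs_trial.
by rewrite mulr_ege1 ?weight_ge1// lerDl sqr_ge0.
Qed.

Lemma cabs_trial_d1_le x : cabs (trial_d1 x) <= (1 + `|a|) * C1 * gauss 2 s x.
Proof.
apply: (cabs_le_gauss (sqr_cabs_trial_d1 x)).
have := sqr_ge0 (x.1 - s); have := sqr_ge0 x.2; have := sqr_ge0 a.
rewrite /weight; nra.
Qed.

Lemma cabs_trial_d2_le x : cabs (trial_d2 x) <= (1 + `|a|) * C1 * gauss 2 s x.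
Proof.
apply: (cabs_le_gauss (sqr_cabs_trial_d2 x)).
have := sqr_ge0 (x.1 - s); have := sqr_ge0 x.2; have := sqr_ge0 a.
rewrite /weight; nra.
Qed.

Lemma trial_weak1 : weak_derivative (e1 R) trial trial_d1.
Proof.
apply: (@weak_derivative_classical _ _ _ _ ((1 + `|a|) * C1) s).
- by left.
- by rewrite /=/envelope; continuity.
- by rewrite /=/envelope; continuity.
- by rewrite /=/envelope; continuity.
- by rewrite /=/envelope; continuity.
- move=> x /=.
  have h := is_deriveM (is_derive_envelope1 x) (is_derive_phase1 (fun t => cos (a * t)) x).
  by apply: is_derive_eq h _; rewrite /GRing.scale/=; ring.
- move=> x /=.
  have h := is_deriveM (is_derive_envelope1 x) (is_derive_phase1 (fun t => sin (a * t)) x).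
  by apply: is_derive_eq h _; rewrite /GRing.scale/=; ring.
- exact: cabs_trial_le.
- exact: cabs_trial_d1_le.
Qed.

Lemma trial_weak2 : weak_derivative (e2 R) trial trial_d2.
Proof.
apply: (@weak_derivative_classical _ _ _ _ ((1 + `|a|) * C1) s).
- by right.
- by rewrite /=/envelope; continuity.
- by rewrite /=/envelope; continuity.
- by rewrite /=/envelope; continuity.
- by rewrite /=/envelope; continuity.
- move=> x /=.
  have h := is_deriveM (is_derive_envelope2 x) (is_derive_cos2 x).
  by apply: is_derive_eq h _; rewrite /GRing.scale/=; ring.
- move=> x /=.
  have h := is_deriveM (is_derive_envelope2 x) (is_derive_sin2 x).
  by apply: is_derive_eq h _; rewrite /GRing.scale/=; ring.
- exact: cabs_trial_le.
- exact: cabs_trial_d2_le.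
Qed.

Lemma weighted_integral (q : R * R -> R) (k : R) : continuous q ->
  (forall x, `|q x| <= k * weight x) ->
  mu2.-integrable setT (EFin \o (fun x => q x * envelope x ^+ 2)) /\
  `|integral2 (fun x => q x * envelope x ^+ 2)| <= k * (C1 * c).
Proof.
move=> cq qk; apply: (@gauss_dominated _ _ _ s).
  apply: continuous_measurable2; apply: continuous_mul2 => //.
  by apply: continuous_exp2; exact: continuous_envelope.
by move=> x; exact: weighted_sqr_envelope_le.
Qed.

Lemma L2_weighted (f : R * R -> R[i]) (q : R * R -> R) (k : R) :
  continuous (fun x => complex.Re (f x)) ->
  continuous (fun x => complex.Im (f x)) ->
  continuous q -> (forall x, cabs (f x) ^+ 2 = q x * envelope x ^+ 2) ->
  (forall x, `|q x| <= k * weight x) -> L2 f.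
Proof.
move=> cr ci cq fq qk; split.
- exact: (measurable_fun_plane (continuous_measurable2 cr)).
- exact: (measurable_fun_plane (continuous_measurable2 ci)).
- have [/integrableP[_] + _] := weighted_integral cq qk.
  congr (_ < _)%E; apply: eq_integral => x _ /=; rewrite fq ger0_norm//.
  by rewrite -fq sqr_ge0.
Qed.

Lemma L2_trial : L2 trial.
Proof.
apply: (@L2_weighted _ (cst 1) 1).
- by rewrite /=/envelope; continuity.
- by rewrite /=/envelope; continuity.
- exact: continuous_cst2.
- by move=> x; rewrite sqr_cabs_trial mul1r.
- by move=> x; rewrite normr1 mul1r weight_ge1.
Qed.

Lemma L2_trial_d1 : L2 trial_d1.
Proof.
apply: (@L2_weighted _ (fun x => (x.1 - s) ^+ 2 / 4) 1).
- by rewrite /=/envelope; continuity.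
- by rewrite /=/envelope; continuity.
- by continuity.
- exact: sqr_cabs_trial_d1.
- move=> x; rewrite ger0_norm ?divr_ge0 ?sqr_ge0// mul1r /weight.
  have := sqr_ge0 (x.1 - s); have := sqr_ge0 x.2; lra.
Qed.

Lemma L2_trial_d2 : L2 trial_d2.
Proof.
apply: (@L2_weighted _ (fun x => x.2 ^+ 2 / 4 + a ^+ 2) (1 + a ^+ 2)).
- by rewrite /=/envelope; continuity.
- by rewrite /=/envelope; continuity.
- by continuity.
- exact: sqr_cabs_trial_d2.
- move=> x; rewrite ger0_norm ?addr_ge0 ?divr_ge0 ?sqr_ge0//.
  have := sqr_ge0 (x.1 - s); have := sqr_ge0 x.2; have := sqr_ge0 a.
  rewrite /weight; nra.
Qed.

Definition trial_H1 : H1 R :=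
  MkH1 L2_trial L2_trial_d1 L2_trial_d2 trial_weak1 trial_weak2.

Lemma Sigma_trial : Sigma trial_H1.
Proof.
apply: (@L2_weighted _ (fun x => eucl x ^+ 2) (2 + 2 * s ^+ 2)).
- by rewrite /=/envelope/eucl; continuity.
- by rewrite /=/envelope/eucl; continuity.
- by rewrite /eucl; continuity.
- by move=> x; rewrite -(sqr_cabs_trial x) -sqr_cabsZ.
- move=> x; rewrite ger0_norm ?sqr_ge0// /eucl sqr_sqrtr ?addr_ge0 ?sqr_ge0//.
  (* This square gives [x.1 ^+ 2 <= 2 (x.1 - s) ^+ 2 + 2 s ^+ 2], the source of the constant
     [2 + 2 * s ^+ 2]. *)
  have := sqr_ge0 (x.1 - s - s); have := sqr_ge0 x.2; have := sqr_ge0 s.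
  have := sqr_ge0 (x.1 - s); rewrite /weight; nra.
Qed.

End trial.

(** * Estimates for the separate terms of the energy of the trial state *)

Section trial_energy.
Variable R : realType.
Variables (c s a : R).
Hypothesis c0 : 0 < c.
Local Notation mu2 := (@lebesgue2 R).
Local Notation envelope := (envelope c s).
Local Notation weight := (weight s).
Local Notation K := (8 * c / normal_peak 2 ^+ 2 * c).
Local Notation rho := (c ^+ 2 / normal_peak 1 ^+ 2).
Local Notation f := (trial_H1 s a c0).
(** Integration against the density of the trial state, whose squared modulus is [envelope ^+ 2]. *)
Let wint q := integral2 (fun x => q x * envelope x ^+ 2).

Lemma abs_le_weight x : `|x.1 - s| <= weight x.
Proof.
have := sqr_ge0 (x.1 - s - 1); have := sqr_ge0 (x.1 - s + 1).
have := sqr_ge0 x.2; rewrite /weight ler_norml !expr2; lra.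
Qed.

Lemma weighted_mass : wint (cst 1) = rho.
Proof.
rewrite /wint /integral2.
rewrite (_ : (fun x => _) = (fun x => rho * gauss 1 s x)); last first.
  by apply/funext => x; rewrite mul1r sqr_envelope.
rewrite RintegralZl//; last exact: integrable_gauss.
by rewrite /Rintegral integral_gauss mulr1.
Qed.

Lemma weighted_bound (q : R * R -> R) (k : R) : continuous q ->
  (forall x, `|q x| <= k * weight x) -> `|wint q| <= k * K.
Proof. by move=> cq qk; have [] := weighted_integral c0 cq qk. Qed.

(** The constant part of a factor is integrated exactly, against the mass [rho]. The terms quadratic
    in [s] thus keep their sharp coefficients while the remainders are only bounded by multiples of
    [K]. *)
Lemma weighted_affine (q : R * R -> R) (k r : R) : continuous q ->
  (forall x, `|q x| <= k * weight x) ->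
  wint (fun x => q x + r) = wint q + r * rho.
Proof.
move=> cq qk.
have [iq _] := weighted_integral c0 cq qk.
have [i1 _] : mu2.-integrable setT (EFin \o (fun x => cst 1 x * envelope x ^+ 2)) /\
    `|wint (cst 1)| <= 1 * K.
  apply: weighted_integral => //; first exact: continuous_cst2.
  by move=> x; rewrite normr1 mul1r weight_ge1.
rewrite -weighted_mass /wint /integral2 -RintegralZl// -RintegralD//; last first.
  exact: (integrableZl measurableT r i1).
by congr fine; apply: eq_integral => x _; rewrite mulrDl mul1r.
Qed.

Lemma sqnormL2_trial : sqnormL2 f = rho.
Proof.
rewrite -weighted_mass; congr fine; apply: eq_integral => x _.
by rewrite /= sqr_cabs_trial mul1r.
Qed.

Lemma sqnormL2_trial_d1 : sqnormL2 (H1_d1 f) <= K.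
Proof.
rewrite /sqnormL2 [leLHS](_ : _ = wint (fun x => (x.1 - s) ^+ 2 / 4)); last first.
  by congr fine; apply: eq_integral => x _; rewrite /= sqr_cabs_trial_d1.
rewrite -[K]mul1r (le_trans (ler_norm _))// weighted_bound//.
  by continuity.
move=> x; rewrite ger0_norm ?divr_ge0 ?sqr_ge0// mul1r /weight.
have := sqr_ge0 (x.1 - s); have := sqr_ge0 x.2; lra.
Qed.

Lemma sqnormL2_trial_d2 : sqnormL2 (H1_d2 f) <= K + a ^+ 2 * rho.
Proof.
have qc : continuous (fun x : R * R => x.2 ^+ 2 / 4) by continuity.
have qle x : `|x.2 ^+ 2 / 4| <= 1 * weight x.
  rewrite ger0_norm ?divr_ge0 ?sqr_ge0// mul1r /weight.
  have := sqr_ge0 (x.1 - s); have := sqr_ge0 x.2; lra.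
rewrite /sqnormL2 [leLHS](_ : _ = wint (fun x => x.2 ^+ 2 / 4 + a ^+ 2)); last first.
  by congr fine; apply: eq_integral => x _; rewrite /= sqr_cabs_trial_d2.
rewrite (weighted_affine _ qc qle) lerD2r -[K]mul1r.
by rewrite (le_trans (ler_norm _))// weighted_bound.
Qed.

Lemma potential_trial (gamma gamma0 V0 : R) : 0 <= gamma0 -> 0 <= V0 -> 0 <= s ->
  integral2 (fun x => potential gamma gamma0 V0 x * cabs (f x) ^+ 2) <=
  (gamma ^+ 2 * (1 + s) + V0) * K + gamma ^+ 2 / 2 * s ^+ 2 * rho.
Proof.
move=> g0 V00 s0.
(* Expanding [x.1 ^+ 2] around [s] leaves the constant [gamma ^+ 2 / 2 * s ^+ 2], to be integrated
   exactly; [q] is the rest of the potential, which grows at most linearly in [s] relative to the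
   weight. *)
pose q (x : R * R) := gamma ^+ 2 / 2 * ((x.1 - s) ^+ 2 + x.2 ^+ 2) +
  gamma ^+ 2 * s * (x.1 - s) +
  V0 * expR (- (gamma0 * (x.1 ^+ 2 + x.2 ^+ 2))).
have qc : continuous q by rewrite /q; continuity.
have qle x : `|q x| <= (gamma ^+ 2 * (1 + s) + V0) * weight x.
  have e1 : expR (- (gamma0 * (x.1 ^+ 2 + x.2 ^+ 2))) <= 1.
    by rewrite -expR0 ler_expR oppr_le0 mulr_ge0// addr_ge0// sqr_ge0.
  have e0 := expR_ge0 (- (gamma0 * (x.1 ^+ 2 + x.2 ^+ 2))).
  have w1 := weight_ge1 s x.
  have Ve0 := mulr_ge0 V00 e0.
  have Ve1 := ler_wpM2l V00 e1.
  have Vw := ler_wpM2l V00 w1.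
  have G0 := sqr_ge0 gamma.
  have Gw : gamma ^+ 2 / 2 * ((x.1 - s) ^+ 2 + x.2 ^+ 2) <= gamma ^+ 2 * weight x.
    have h : (x.1 - s) ^+ 2 + x.2 ^+ 2 <= 2 * weight x.
      by rewrite /weight; have := sqr_ge0 (x.1 - s); have := sqr_ge0 x.2; lra.
    by have := ler_wpM2l G0 h; lra.
  have Gp : 0 <= gamma ^+ 2 / 2 * ((x.1 - s) ^+ 2 + x.2 ^+ 2).
    by rewrite mulr_ge0 ?divr_ge0 ?addr_ge0 ?sqr_ge0.
  have Gs0 := mulr_ge0 G0 s0.
  have Gs : `|gamma ^+ 2 * s * (x.1 - s)| <= gamma ^+ 2 * s * weight x.
    by rewrite normrM (ger0_norm Gs0) ler_wpM2l ?abs_le_weight.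
  move: Gs; rewrite ler_norml => /andP[Gs1 Gs2].
  rewrite /q ler_norml; lra.
rewrite [leLHS](_ : _ = wint (fun x => q x + gamma ^+ 2 / 2 * s ^+ 2)); last first.
  congr fine; apply: eq_integral => x _; rewrite /= sqr_cabs_trial /potential /q /eucl.
  by rewrite sqr_sqrtr ?addr_ge0 ?sqr_ge0//; congr (_ * _)%:E; field.
rewrite (weighted_affine _ qc qle) lerD2r.
by rewrite (le_trans (ler_norm _))// weighted_bound.
Qed.

(** The derivatives of the envelope contribute only to the imaginary part of the integrand; the
    phase leaves the real part [a * x.1] times the density. Writing [x.1] as [x.1 - s + s] separates
    the exact term [s * rho] from a centred moment bounded by [K]. *)
Lemma angular_momentum_trial : 0 <= a ->
  a * (s * rho - K) <= complex.Re (angular_momentum f).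
Proof.
move=> a0.
have qc : continuous (fun x : R * R => x.1 - s) by continuity.
have qle x : `|x.1 - s| <= 1 * weight x by rewrite mul1r abs_le_weight.
have qsc : continuous (fun x : R * R => x.1 - s + s) by continuity.
have qsle x : `|x.1 - s + s| <= (1 + `|s|) * weight x.
  rewrite (le_trans (ler_normD _ _))// mulrDl mul1r lerD ?abs_le_weight//.
  by rewrite ler_peMr ?weight_ge1.
have [i1 _] := weighted_integral c0 qsc qsle.
rewrite /= [leRHS](_ : _ = a * wint (fun x => x.1 - s + s)); last first.
  rewrite /wint /integral2 -RintegralZl//.
  congr fine; apply: eq_integral => x _; congr EFin; rewrite subrK /=.
  transitivity (a * (x.1 * envelope x ^+ 2) *
    (cos (a * x.2) ^+ 2 + sin (a * x.2) ^+ 2)); last by rewrite cos2Dsin2 mulr1.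
  by move: (envelope x) (cos _) (sin _) => e C S; field.
rewrite ler_wpM2l// (weighted_affine _ qc qle).
have := weighted_bound qc qle; rewrite mul1r ler_norml => /andP[h _].
by rewrite addrC lerD2r.
Qed.

(** The inequality [ln t < t], used at [y] and at its inverse, controls the logarithm for large and
    for small [y]. *)
Lemma abs_sqr_ln_le (y : R) : 0 < y -> `|y ^+ 2 * ln y| <= y * (y ^+ 2 + 1).
Proof.
move=> y0; have h1 := ln_sublinear y0.
have h2 : - ln y < y^-1 by rewrite -lnV ?posrE// ln_sublinear// invr_gt0.
rewrite normrM ger0_norm ?sqr_ge0// [y ^+ 2]expr2 -mulrA ler_pM2l//.
have h3 : - (y * ln y) <= 1.
  by rewrite -mulrN -(divff (lt0r_neq0 y0)) ler_pM2l//; exact: ltW.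
have h4 : y * ln y <= y * y by rewrite ler_pM2l//; exact: ltW.
rewrite -[X in X * _]gtr0_norm// -normrM ler_norml.
have := mulr_gt0 y0 y0; lra.
Qed.

Lemma nonlinear_trial :
  integral2 (fun x =>
    cabs (f x) ^+ 4 * ln (cabs (f x) ^+ 2 / Num.sqrt (expR 1))) <=
  Num.sqrt (expR 1) * (c ^+ 4 + 1) * K.
Proof.
set r := Num.sqrt (expR 1).
have r1 : 1 <= r by rewrite -sqrtr1 ler_wsqrtr// -expR0 ler_expR.
have r0 : 0 < r by rewrite (lt_le_trans ltr01).
have e0 x := envelope_gt0 s c0 x.
rewrite [leLHS](_ : _ =
  integral2 (fun x => envelope x ^+ 4 * ln (envelope x ^+ 2 / r))); last first.
  congr fine; apply: eq_integral => x _.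
  by rewrite -[4%N]/(2 * 2)%N !exprM !(sqr_cabs_trial c s a).
rewrite (le_trans (ler_norm _))//.
have [||//] := @gauss_dominated _
  (fun x => envelope x ^+ 4 * ln (envelope x ^+ 2 / r)) (r * (c ^+ 4 + 1) * K) s.
  have me : measurable_fun [set: plane R] envelope.
    exact: (continuous_measurable2 (@continuous_envelope _ c s)).
  apply: measurable_funM; first exact: measurable_funX.
  apply: measurableT_comp => //; apply: measurable_funM => //.
  exact: measurable_funX.
(* In terms of [y] the integrand is [r ^+ 2 * (y ^+ 2 * ln y)]. As [r >= 1], [y] stays below
   [c ^+ 2], so the logarithmic bound leaves a constant times [r * y], which is the density
   itself. *)
move=> x; set y := envelope x ^+ 2 / r.
have y0 : 0 < y by rewrite divr_gt0// exprn_gt0.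
have ey : envelope x ^+ 2 = r * y by rewrite /y mulrCA divff ?mulr1// gt_eqF.
have yc : y <= c ^+ 2.
  rewrite ler_pdivrMr// (le_trans (_ : _ <= c ^+ 2)) ?ler_peMr ?sqr_ge0//.
  by rewrite ler_sqr ?nnegrE ?(ltW (e0 x)) ?(ltW c0)// envelope_le.
have e4 : envelope x ^+ 4 = r ^+ 2 * y ^+ 2.
  by rewrite -[4%N]/(2 * 2)%N exprM ey exprMn.
have step1 : r ^+ 2 * `|y ^+ 2 * ln y| <= r * (c ^+ 4 + 1) * (r * y).
  rewrite (le_trans (ler_wpM2l (sqr_ge0 r) (abs_sqr_ln_le y0)))//.
  have : y ^+ 2 + 1 <= c ^+ 4 + 1.
    by rewrite lerD2r -[4%N]/(2 * 2)%N exprM ler_sqr ?nnegrE ?sqr_ge0// (ltW y0).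
  move=> /(ler_wpM2l (mulr_ge0 (ltW (mulr_gt0 r0 r0)) (ltW y0))).
  by congr (_ <= _); ring.
have k0 : 0 <= r * (c ^+ 4 + 1).
  by rewrite mulr_ge0 ?(ltW r0)// addr_ge0// exprn_ge0// ltW.
rewrite e4 -[r ^+ 2 * _ * _]mulrA normrM (ger0_norm (sqr_ge0 r)).
apply: (le_trans step1); rewrite -ey.
have := @weighted_sqr_envelope_le _ c s c0 (cst 1) 1 x.
rewrite /= normr1 !mul1r weight_ge1 => /(_ isT) h.
have := ler_wpM2l k0 (le_trans (ler_norm _) h).
by rewrite [leRHS]mulrA.
Qed.

End trial_energy.

(** * Summation of the estimates and divergence of the energy as the translation grows *)

Section conclusion.
Variable R : realType.

(** The boost [a = Omega * s] minimises [a ^+ 2 / 2 - Omega * a * s]. The coefficients of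
    [rho * s ^+ 2] then add up to [Omega ^+ 2 / 2 + gamma ^+ 2 / 2 - Omega ^+ 2]; the linear term
    collects the errors of the trap and of the rotation. *)
Lemma trial_energy_le (c s gamma gamma0 V0 Omega K rho : R) (c0 : 0 < c) :
  K = 8 * c / normal_peak 2 ^+ 2 * c ->
  rho = c ^+ 2 / normal_peak 1 ^+ 2 ->
  0 <= gamma0 -> 0 <= V0 -> 0 <= s -> 0 <= Omega ->
  energy gamma gamma0 V0 Omega (trial_H1 s (Omega * s) c0) <=
  (1 + gamma ^+ 2 + V0 + 2^-1 * (Num.sqrt (expR 1) * (c ^+ 4 + 1))) * K +
  (gamma ^+ 2 + Omega ^+ 2) * K * s -
  (Omega ^+ 2 - gamma ^+ 2) / 2 * rho * s ^+ 2.
Proof.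
move=> KE rhoE g0 V00 s0 O0.
have h1 := sqnormL2_trial_d1 s (Omega * s) c0.
have h2 := sqnormL2_trial_d2 s (Omega * s) c0.
have h3 := potential_trial (Omega * s) c0 gamma g0 V00 s0.
have h4 := nonlinear_trial s (Omega * s) c0.
have h5 := ler_wpM2l O0 (angular_momentum_trial s c0 (mulr_ge0 O0 s0)).
rewrite /energy; move: h1 h2 h3 h4 h5; rewrite -KE -rhoE.
move: (sqnormL2 _) (sqnormL2 _) (integral2 _) (integral2 _) (complex.Re _).
by move=> x1 x2 x3 x4 x5; lra.
Qed.

Lemma quadratic_unbounded_below (A B D M : R) : 0 < D ->
  exists2 s, 0 <= s & A + B * s - D * s ^+ 2 <= M.
Proof.
(* With this choice [D * s] exceeds [|A| + |M| + |B|] and [s >= 1], so [D * s ^+ 2] dominates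
   [|A| + |M| + |B| * s]. *)
move=> D0; set s := 1 + (`|A| + `|M| + `|B|) / D.
have t0 : 0 <= (`|A| + `|M| + `|B|) / D by rewrite divr_ge0 ?addr_ge0// ltW.
have s1 : 1 <= s by rewrite lerDl.
have Ds : D * s = D + (`|A| + `|M| + `|B|).
  by rewrite /s mulrDr mulr1 mulrCA divff ?mulr1// gt_eqF.
exists s; first exact: le_trans s1.
rewrite expr2 mulrA Ds.
have := ler_norm A; have := ler_norm B; have := ler_norm (- M); rewrite normrN.
have := normr_ge0 A; have := normr_ge0 B; have := normr_ge0 M.
move: `|A| `|B| `|M| => a b m m0 b0 a0 mM bB aA; nra.
Qed.

End conclusion.

Theorem theorem1p7 (R : realType) (gamma gamma0 V0 Omega : R)
    (hgamma : 0 < gamma) (hgamma0 : 0 < gamma0) (hV0 : 0 <= V0)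
    (hOmega : gamma < Omega) (rho : R) (hrho : 0 < rho) :
  min_energy gamma gamma0 V0 Omega rho = -oo%E /\
  ~ (exists f : H1 R, minimizer gamma gamma0 V0 Omega rho f).
Proof.
suff Eoo : min_energy gamma gamma0 V0 Omega rho = -oo%E.
  (* The energy of a minimizer is a real number, hence different from [-oo]. *)
  by split => // -[f [_]]; rewrite Eoo.
have p0 : 0 < normal_peak (1 : R) by rewrite normal_peak_gt0.
(* The squared envelope has mass [c ^+ 2 / normal_peak 1 ^+ 2]; this amplitude makes it equal to
   [rho]. *)
pose c := Num.sqrt rho * normal_peak 1.
have c0 : 0 < c by rewrite mulr_gt0// sqrtr_gt0.
have cE : c ^+ 2 / normal_peak 1 ^+ 2 = rho.
  by rewrite exprMn mulfK ?expf_neq0 ?gt_eqF// sqr_sqrtr// ltW.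
apply: eq_ninfty => M.
(* Fast rotation enters here: [0 < gamma < Omega] makes the coefficient of [- s ^+ 2] positive. *)
have D0 : 0 < (Omega ^+ 2 - gamma ^+ 2) / 2 * rho.
  by rewrite mulr_gt0// divr_gt0// subr_gt0 ltr_pXn2r// nnegrE ltW// (lt_trans hgamma).
have [s s0 hs] := quadratic_unbounded_below
  ((1 + gamma ^+ 2 + V0 + 2^-1 * (Num.sqrt (expR 1) * (c ^+ 4 + 1))) *
    (8 * c / normal_peak 2 ^+ 2 * c))
  ((gamma ^+ 2 + Omega ^+ 2) * (8 * c / normal_peak 2 ^+ 2 * c)) M D0.
have O0 : 0 <= Omega by rewrite ltW// (lt_trans hgamma).
have := trial_energy_le gamma c0 erefl (esym cE) (ltW hgamma0) hV0 s0 O0.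
move=> /le_trans/(_ hs) EM.
rewrite -lee_fin in EM; apply: le_trans EM.
apply: ereal_inf_lbound; exists (trial_H1 s (Omega * s) c0) => //.
by split; [exact: Sigma_trial|rewrite sqnormL2_trial].
Qed.
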